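(* Let $d\ge1$ and let $\alpha_j,\beta_j,\rho_j\in\mathbf R$ be such that $$\beta_j>\alpha_j,\quad \rho_j>0\quad\text{and}\quad \rho_j(\beta_j-\alpha_j)<\pi,\qquad j=1,\dots,d.$$ Let $F$ be analytic in $$\Omega=\{\,z\in\mathbf C^d\,;\ \alpha_j<\operatorname{Arg}(z_j)<\beta_j,\ j=1,\dots,d\,\}$$ and continuous on $\overline\Omega$. Suppose that for some constants $C,M,r_j\ge0$, $j=1,\dots,d$, $$|F(z)|\le M\quad\text{whenever } \operatorname{Arg}(z_j)\in\{\alpha_j,\beta_j\}\text{ for all } j=1,\dots,d,$$ and $$|F(z)|\le C\prod_{j=1}^d e^{r_j|z_j|^{\rho_j}},\qquad z\in\Omega.$$ Then $$|F(z)|\le M,\qquad z\in\overline\Omega.$$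
   Context: $\operatorname{Arg}(w)\in I$ for a set $I\subseteq\mathbf R$ means that $w\in\mathbf C\setminus\{0\}$ has an argument in $I$, i.e. $w=|w|e^{i\theta}$ for some $\theta\in I$. Thus the first bound is assumed on the product of the boundary rays of the $d$ sectors (the distinguished boundary of $\Omega$). *)

(* Defs.v *)
From HB Require Import structures.
From mathcomp Require Import all_boot all_order all_algebra.
From mathcomp Require Import finmap.
From mathcomp Require Import all_classical all_reals all_analysis.
From mathcomp Require Export complex.
From mathcomp Require summability.

Set Implicit Arguments.
Unset Strict Implicit.
Unset Printing Implicit Defensive.

Import Order.TTheory GRing.Theory Num.Theory.
Import numFieldNormedType.Exports.

Local Open Scope classical_set_scope.
Local Open Scope ring_scope.
Local Open Scope complex_scope.

(* The library declares the metric topology only on variables of an abstract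
   numeric field type; we transport it to the concrete field R[i]. *)
HB.instance Definition _ (R : realType) := NormedModule.copy R[i] R[i]^o.

Notation cabs := ComplexField.Normc.normc.

Section Defs.
Variable R : realType.

Definition arg_in (I : set R) (w : R[i]) : Prop :=
  w != 0 /\ exists2 t : R, I t & w = (cabs w)%:C * (cos t +i* sin t).

Variable d : nat.

(* c is indexed by multi-indices, and the sum of the power series is
   unordered (the limit along finite sets of multi-indices ordered by
   inclusion), which for complex terms amounts to absolute convergence. *)
Definition analytic_at (F : 'rV[R[i]]_d -> R[i]) (a : 'rV[R[i]]_d) : Prop :=
  exists (e : R) (c : {ffun 'I_d -> nat} -> R[i]), 0 < e /\
    forall z : 'rV[R[i]]_d, (forall j, cabs (z 0 j - a 0 j) < e) ->
      summability.partial_sum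
        (fun k => c k * \prod_(j < d) (z 0 j - a 0 j) ^+ k j)
        @ summability.totally --> F z.

Definition analytic_on (D : set 'rV[R[i]]_d) (F : 'rV[R[i]]_d -> R[i]) : Prop :=
  forall a, D a -> analytic_at F a.

Definition sectors (al be : 'I_d -> R) : set 'rV[R[i]]_d :=
  [set z | forall j, arg_in `]al j, be j[ (z 0 j)].

Definition boundary_rays (al be : 'I_d -> R) : set 'rV[R[i]]_d :=
  [set z | forall j, arg_in [set al j; be j] (z 0 j)].

End Defs.

(* Main.v *)
Require Import Defs.
From mathcomp Require Import all_boot all_order all_algebra.
From mathcomp Require Import finmap.
From mathcomp Require Import all_classical all_reals all_analysis.
From mathcomp Require Import ring lra.
From mathcomp Require summability.

Import Order.TTheory GRing.Theory Num.Theory.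
Import numFieldNormedType.Exports.
Local Open Scope classical_set_scope.
Local Open Scope ring_scope.
Local Open Scope complex_scope.

(** The proof is a Phragmen-Lindelof argument in logarithmic coordinates
    [z_j = exp (x_j + i y_j)], which turn the sectors into a product of strips
    [al j < y_j < be j]. Choose [rho j < s j < t j < pi / (be j - al j)], let [c_j]
    be the middle of the strip and

      [p_j (x, y) = 2 * cosh (s j * x) * cos (t j * (y - c_j))].

    On the closed strip [p_j] is positive and grows like [exp (s j * |x|)], faster
    than the admissible growth [exp (rho j * x)] of [log |F|]. Hence, for every
    [eps > 0], the damped modulus [u = |F| * exp (- eps * \sum_j p_j)] tends to 0
    when any of the [|x_j|] tends to infinity ([damped_far]).

    The function [p_j] is strictly superharmonic, its Laplacian being
    [(s j ^ 2 - t j ^ 2) * p_j < 0], whereas [log |F|] is harmonic in each variable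
    away from its zeros; so [u] has no positive local maximum in any single
    variable ([damped_not_max]). This is proved in discrete form, with averages
    over the four points [w_j + h, w_j - h, w_j + i h, w_j - i h]. It only requires
    a second-order Taylor expansion of [F] in one variable, which is read off the
    power series ([expands2_slice]) and composed with the exponential
    ([expands2_comp], [cexp_expands2]). Zeros of [F] are harmless because only
    points with [u > 0] matter.

    It follows that over a large box slightly inside the strips the maximum of [u]
    is attained at a point all of whose imaginary parts are extremal ([box_max]).
    Letting the box fill the closed strips, continuity of [F] up to the boundary
    gives a point over the product of the boundary rays where [u] is at least as
    large as at a given interior point ([distinguished_boundary_max]). There [u] is
    at most [M]. Finally [eps] tends to 0. *)

Set Implicit Arguments.
Unset Strict Implicit.
Unset Printing Implicit Defensive.

(** * The complex modulus *)

Section Cabs.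
Variable R : realType.
Implicit Types z w : R[i].

Lemma cabs_ge0 z : 0 <= cabs z.
Proof. by case: z => a b; exact: sqrtr_ge0. Qed.

Lemma cabsM z w : cabs (z * w) = cabs z * cabs w.
Proof. exact: Normc.normcM. Qed.

Lemma cabsD z w : cabs (z + w) <= cabs z + cabs w.
Proof. exact: le_normcD. Qed.

Lemma cabsN z : cabs (- z) = cabs z.
Proof. exact: normcN. Qed.

Lemma cabsB z w : cabs (z - w) <= cabs z + cabs w.
Proof. by rewrite -(cabsN w) cabsD. Qed.

Lemma cabsBC z w : cabs (z - w) = cabs (w - z).
Proof. by rewrite -cabsN opprB. Qed.

Lemma cabs_sub z w : cabs z <= cabs w + cabs (z - w).
Proof. by have := cabsD w (z - w); rewrite subrKC. Qed.

Lemma cabsX z n : cabs (z ^+ n) = cabs z ^+ n.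
Proof.
by elim: n => [|n IH]; rewrite ?expr0 ?Normc.normc1// !exprS cabsM IH.
Qed.

Lemma cabsR (x : R) : cabs x%:C = `|x|.
Proof. by rewrite /= expr0n addr0 sqrtr_sqr. Qed.

Lemma cabs_i : cabs ('i%C : R[i]) = 1.
Proof. by rewrite /= expr0n expr1n add0r sqrtr1. Qed.

Lemma cabs_Re z : `|complex.Re z| <= cabs z.
Proof.
case: z => a b /=; rewrite -sqrtr_sqr; apply: ler_wsqrtr.
by rewrite lerDl sqr_ge0.
Qed.

Lemma cabs_Im z : `|complex.Im z| <= cabs z.
Proof.
case: z => a b /=; rewrite -sqrtr_sqr; apply: ler_wsqrtr.
by rewrite lerDr sqr_ge0.
Qed.

Lemma cabs_ReIm (a b : R) : cabs (a +i* b) <= `|a| + `|b|.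
Proof.
rewrite [a +i* b]complexE (le_trans (cabsD _ _))// cabsM !cabsR.
by rewrite cabs_i mul1r.
Qed.

Lemma cabs_sum (I : Type) (r : seq I) (P : pred I) (f : I -> R[i]) :
  cabs (\sum_(i <- r | P i) f i) <= \sum_(i <- r | P i) cabs (f i).
Proof.
elim/big_rec2 : _ => [|i y x _ h]; first by rewrite Normc.normc0.
by rewrite (le_trans (cabsD _ _))// lerD2l.
Qed.

End Cabs.

(** * Second-order expansions at a point *)

Section Expansions.
Variable R : realType.
Implicit Types f g : R[i] -> R[i].

(** Explicit constants, rather than a filter, since they are computed with in
    the four-point estimate. *)
Definition bigO_at0 n f := exists (K s : R), [/\ 0 <= K, 0 < s &
  forall h, cabs h < s -> cabs (f h) <= K * cabs h ^+ n].

Lemma bigO_at0_ext n f g : f =1 g -> bigO_at0 n f -> bigO_at0 n g.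
Proof.
by move=> fg [K [s [K0 s0 H]]]; exists K, s; split=> // h hs; rewrite -fg H.
Qed.

Lemma bigO_at0D n f g : bigO_at0 n f -> bigO_at0 n g ->
  bigO_at0 n (fun h => f h + g h).
Proof.
move=> [K [s [K0 s0 H]]] [L [t [L0 t0 H']]]; exists (K + L), (Num.min s t).
split; [exact: addr_ge0|by rewrite lt_min s0|].
move=> h; rewrite lt_min => /andP[hs ht].
by rewrite mulrDl (le_trans (cabsD _ _))// lerD ?H ?H'.
Qed.

Lemma bigO_at0M n m f g : bigO_at0 n f -> bigO_at0 m g ->
  bigO_at0 (n + m) (fun h => f h * g h).
Proof.
move=> [K [s [K0 s0 H]]] [L [t [L0 t0 H']]]; exists (K * L), (Num.min s t).
split; [exact: mulr_ge0|by rewrite lt_min s0|].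
move=> h; rewrite lt_min => /andP[hs ht].
by rewrite cabsM exprD mulrACA ler_pM ?cabs_ge0 ?H ?H'.
Qed.

Lemma bigO_at0W n m f : (m <= n)%N -> bigO_at0 n f -> bigO_at0 m f.
Proof.
move=> mn [K [s [K0 s0 H]]]; exists K, (Num.min s 1).
split; [by []|by rewrite lt_min s0 ltr01|].
move=> h; rewrite lt_min => /andP[hs h1]; rewrite (le_trans (H _ hs))//.
by rewrite ler_wpM2l// ler_wiXn2l ?cabs_ge0// ltW.
Qed.

Lemma bigO_at0_cst (c : R[i]) : bigO_at0 0 (fun=> c).
Proof.
by exists (cabs c), 1; split; rewrite ?cabs_ge0// => h _; rewrite expr0 mulr1.
Qed.

Lemma bigO_at0_id : bigO_at0 1 id.
Proof. by exists 1, 1; split=> // h _; rewrite mul1r expr1. Qed.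

Lemma bigO_at0X n f k : bigO_at0 n f -> bigO_at0 (n * k) (fun h => f h ^+ k).
Proof.
move=> fn; elim: k => [|k IH].
  by rewrite muln0; apply: bigO_at0_ext (bigO_at0_cst 1) => h; rewrite expr0.
rewrite mulnS; apply: bigO_at0_ext (bigO_at0M fn IH) => h.
by rewrite exprS.
Qed.

Lemma bigO_at0_comp n f g : bigO_at0 n f -> bigO_at0 1 g ->
  bigO_at0 n (fun h => f (g h)).
Proof.
move=> [K [s [K0 s0 H]]] [L [t [L0 t0 H']]].
exists (K * L ^+ n), (Num.min t (s / (L + 1))); split.
- by rewrite mulr_ge0// exprn_ge0.
- by rewrite lt_min t0 divr_gt0// ltr_wpDl.
move=> h; rewrite lt_min => /andP[ht hs].
have gL : cabs (g h) <= L * cabs h by rewrite -[cabs h]expr1 H'.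
have gs : cabs (g h) < s.
  apply: le_lt_trans gL _; move: hs; rewrite ltr_pdivlMr ?ltr_wpDl// => hs.
  by have := cabs_ge0 h; lra.
rewrite (le_trans (H _ gs))// -mulrA ler_wpM2l// -exprMn.
by rewrite lerXn2r// ?nnegrE ?mulr_ge0 ?cabs_ge0.
Qed.

(** This weak form of holomorphy at 0 is all that the maximum principle below
    uses; unlike a power series it is immediately stable under composition. *)
Definition expands2 f := exists c0 c1 c2 : R[i],
  bigO_at0 3 (fun h => f h - (c0 + c1 * h + c2 * h ^+ 2)).

Lemma bigO_at0_poly (c0 c1 c2 : R[i]) :
  bigO_at0 0 (fun h => c0 + c1 * h + c2 * h ^+ 2).
Proof.
apply: bigO_at0D; first apply: bigO_at0D.
- exact: bigO_at0_cst.
- apply: (@bigO_at0W 1) => //.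
  exact: (bigO_at0M (bigO_at0_cst c1) bigO_at0_id).
- apply: (@bigO_at0W 2) => //.
  exact: (bigO_at0M (bigO_at0_cst c2) (bigO_at0X 2 bigO_at0_id)).
Qed.

Lemma bigO_at0_horner (c1 c2 : R[i]) :
  bigO_at0 1 (fun h => c1 * h + c2 * h ^+ 2).
Proof.
apply: bigO_at0_ext (bigO_at0M bigO_at0_id (bigO_at0_poly c1 c2 0)) => h.
by ring.
Qed.

Lemma expands2_coef0 f c0 c1 c2 :
  bigO_at0 3 (fun h => f h - (c0 + c1 * h + c2 * h ^+ 2)) -> f 0 = c0.
Proof.
case=> K [s [K0 s0 /(_ 0)]]; rewrite Normc.normc0 => /(_ s0).
rewrite !expr0n !mulr0 !addr0 => h.
by apply/eqP; rewrite -subr_eq0; apply/eqP/Normc.eq0_normc/eqP;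
  rewrite eq_le h cabs_ge0.
Qed.

(** Composition at 0 needs [g 0 = 0]; the coefficients are those of the
    composed Taylor polynomials, and everything else is absorbed by the
    calculus of [bigO_at0]. *)
Lemma expands2_comp f g : g 0 = 0 -> expands2 f -> expands2 g ->
  expands2 (fun h => f (g h)).
Proof.
move=> g0 [c0 [c1 [c2 fO]]] [d0 [d1 [d2 gO]]].
have d00 : d0 = 0 by rewrite -(expands2_coef0 gO).
rewrite {d0}d00 in gO.
have g1 : bigO_at0 1 g.
  apply: bigO_at0_ext (bigO_at0D (bigO_at0W (isT : (1 <= 3)%N) gO)
    (bigO_at0_horner d1 d2)) => h; by ring.
have g2 : bigO_at0 2 (fun h => g h - d1 * h).
  apply: bigO_at0_ext (bigO_at0D (bigO_at0W (isT : (2 <= 3)%N) gO)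
    (bigO_at0M (bigO_at0_cst d2) (bigO_at0X 2 bigO_at0_id))) => h; by ring.
exists c0, (c1 * d1), (c1 * d2 + c2 * d1 ^+ 2).
have O1 : bigO_at0 3 (fun h => c2 * ((g h - d1 * h) * (g h + d1 * h))).
  have g1' := bigO_at0D g1 (bigO_at0M (bigO_at0_cst d1) bigO_at0_id).
  exact: (bigO_at0M (bigO_at0_cst c2) (bigO_at0M g2 g1')).
apply: bigO_at0_ext (bigO_at0D (bigO_at0D (bigO_at0_comp fO g1)
  (bigO_at0M (bigO_at0_cst c1) gO)) O1) => h.
by ring.
Qed.

(** The product of a polynomial over the four rotations of [h] is invariant
    under multiplication of [h] by i, hence a polynomial in [h ^+ 4]: the terms
    of orders 1, 2 and 3 of the Taylor polynomial disappear. *)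
Lemma expands2_rotations f : expands2 f ->
  bigO_at0 3 (fun h =>
    f h * f (- h) * (f ('i%C * h) * f (- ('i%C * h))) - f 0 ^+ 4).
Proof.
move=> [c0 [c1 [c2 fO]]]; rewrite (expands2_coef0 fO).
pose P (h : R[i]) := c0 + c1 * h + c2 * h ^+ 2.
pose D := 2 * c0 * c2 - c1 ^+ 2.
have negO : bigO_at0 1 (fun h : R[i] => - h).
  by apply: bigO_at0_ext (bigO_at0M (bigO_at0_cst (-1)) bigO_at0_id) => h; ring.
have iO : bigO_at0 1 (fun h : R[i] => 'i%C * h).
  exact: (bigO_at0M (bigO_at0_cst 'i%C) bigO_at0_id).
have P0 : bigO_at0 0 P := bigO_at0_poly c0 c1 c2.
have f0 : bigO_at0 0 f.
  apply: bigO_at0_ext (bigO_at0D (bigO_at0W (isT : (0 <= 3)%N) fO) P0) => h.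
  by rewrite /P; ring.
(* [Q] is [P h * P (- h)], whose middle coefficient changes sign when [h] is
   multiplied by i. *)
pose Q (h : R[i]) := c0 ^+ 2 + D * h ^+ 2 + c2 ^+ 2 * h ^+ 4.
have QO : bigO_at0 3 (fun h => f h * f (- h) - Q h).
  apply: bigO_at0_ext (bigO_at0D (bigO_at0M fO (bigO_at0_comp f0 negO))
    (bigO_at0M P0 (bigO_at0_comp fO negO))) => h.
  by rewrite /P /Q /D; ring.
have Q0 : bigO_at0 0 Q.
  apply: bigO_at0_ext (bigO_at0_comp (bigO_at0_poly (c0 ^+ 2) D (c2 ^+ 2))
    (bigO_at0W (isT : (1 <= 2)%N) (bigO_at0X 2 bigO_at0_id))) => h.
  by rewrite /Q; ring.
have ff0 : bigO_at0 0 (fun h => f h * f (- h)).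
  exact: (bigO_at0M f0 (bigO_at0_comp f0 negO)).
pose S (h : R[i]) := 2 * c0 ^+ 2 * c2 ^+ 2 - D ^+ 2 + c2 ^+ 4 * h ^+ 4.
have SO : bigO_at0 3 (fun h => h ^+ 4 * S h).
  apply: (bigO_at0W (isT : (3 <= 4 + 0)%N)).
  apply: (bigO_at0M (bigO_at0X 4 bigO_at0_id)).
  apply: (bigO_at0D (bigO_at0_cst _)).
  exact: (bigO_at0M (bigO_at0_cst _)
    (bigO_at0W (isT : (0 <= 4)%N) (bigO_at0X 4 bigO_at0_id))).
apply: bigO_at0_ext (bigO_at0D (bigO_at0D
  (bigO_at0M QO (bigO_at0_comp ff0 iO))
  (bigO_at0M Q0 (bigO_at0_comp QO iO))) SO) => h /=.
have i2 : ('i%C * h) ^+ 2 = - h ^+ 2 by rewrite exprMn sqr_i mulN1r.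
have i4 : ('i%C * h) ^+ 4 = h ^+ 4.
  by rewrite -[4%N]/(2 * 2)%N !exprM i2 sqrrN.
rewrite /Q i2 i4 /S.
by ring.
Qed.

End Expansions.

(** * Taylor estimates for exp, cos and sin *)

Section RealEstimates.
Variable R : realType.
Implicit Types x y t : R.

(** Mean value theorem; the Taylor estimates below follow by iterating it from a
    bound on the last derivative. *)
Lemma norm_le_of_derive (f df : R -> R) (K : R) n :
  (forall x, is_derive x (1 : R) f (df x)) -> f 0 = 0 ->
  (forall x, `|x| <= 1 -> `|df x| <= K * `|x| ^+ n) ->
  forall x, `|x| <= 1 -> `|f x| <= K * `|x| ^+ n.+1.
Proof.
move=> fdf f0 Hdf x x1.
have fc (A : set R) : {within A, continuous f}.
  apply: continuous_subspaceT => y; apply/differentiable_continuous.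
  by apply/derivable1_diffP; have [] := fdf y.
suff [c cx ->] : exists2 c, `|c| <= `|x| & f x = df c * x.
  rewrite normrM exprSr mulrA ler_wpM2r// (le_trans (Hdf _ (le_trans cx x1)))//.
  have K0 : 0 <= K.
    by have := Hdf 1; rewrite normr1 expr1n mulr1 => /(_ (lexx _)); apply: le_trans.
  by rewrite ler_wpM2l// lerXn2r// nnegrE.
have [x0|x0] := leP 0 x.
  have [c] := MVT_segment x0 (fun y _ => fdf y) (fc _).
  rewrite in_itv/= f0 !subr0 => /andP[c0 cx] ->; exists c => //.
  by rewrite !ger0_norm.
have [c] := MVT_segment (ltW x0) (fun y _ => fdf y) (fc _).
rewrite in_itv/= f0 !sub0r => /andP[cx c0] /eqP; rewrite mulrN eqr_opp => /eqP ->.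
by exists c => //; rewrite !ler0_norm ?lerN2// ltW.
Qed.

Lemma expR_taylor2 x : `|x| <= 1 ->
  `|expR x - (1 + x + x ^+ 2 / 2)| <= expR 1 * `|x| ^+ 3.
Proof.
have E0 : forall y, `|y| <= 1 -> `|expR y| <= expR 1 * `|y| ^+ 0.
  move=> y y1; rewrite expr0 mulr1 ger0_norm ?expR_ge0// ler_expR.
  exact: le_trans (ler_norm _) y1.
have E1 : forall y, `|y| <= 1 -> `|expR y - 1| <= expR 1 * `|y| ^+ 1.
  apply: norm_le_of_derive E0; last by rewrite expR0 subrr.
  by move=> y; apply: (is_derive_eq (is_deriveB (is_derive_expR y)
    (is_derive_cst (1 : R) y 1))); rewrite subr0.
have E2 : forall y, `|y| <= 1 -> `|expR y - 1 - y| <= expR 1 * `|y| ^+ 2.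
  apply: norm_le_of_derive E1; last by rewrite expR0 subrr subr0.
  by move=> y; apply: (is_derive_eq (is_deriveB (is_deriveB (is_derive_expR y)
    (is_derive_cst (1 : R) y 1)) (is_derive_id y 1))); rewrite subr0.
suff E3 : forall y, `|y| <= 1 ->
    `|expR y - 1 - y - 2^-1 * y ^+ 2| <= expR 1 * `|y| ^+ 3.
  by move=> /E3; congr (`| _ | <= _); ring.
apply: norm_le_of_derive E2; last by rewrite expR0; ring.
move=> y; apply: (is_derive_eq (is_deriveB (is_deriveB (is_deriveB
  (is_derive_expR y) (is_derive_cst (1 : R) y 1)) (is_derive_id y 1))
  (is_deriveZ 2^-1 (is_deriveX 2 (is_derive_id y (1 : R)))))).
rewrite /= !subr0.
congr (_ - _); rewrite /GRing.scale/= expr1 !mulr_natl mulr1; lra.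
Qed.

Lemma sin_taylor2 x : `|x| <= 1 -> `|sin x - x| <= `|x| ^+ 3.
Proof.
have S0 : forall y, `|y| <= 1 -> `|cos y| <= 1 * `|y| ^+ 0.
  by move=> y _; rewrite expr0 mulr1 cos_max.
have S1 : forall y, `|y| <= 1 -> `|sin y| <= 1 * `|y| ^+ 1.
  by apply: norm_le_of_derive S0; rewrite sin0.
have S2 : forall y, `|y| <= 1 -> `|cos y - 1| <= 1 * `|y| ^+ 2.
  apply: (@norm_le_of_derive _ (fun y => - sin y)).
  - by move=> y; apply: (is_derive_eq (is_deriveB (is_derive_cos y)
      (is_derive_cst (1 : R) y 1))); rewrite subr0.
  - by rewrite cos0 subrr.
  - by move=> y y1; rewrite normrN S1.
have S3 : forall y, `|y| <= 1 -> `|sin y - y| <= 1 * `|y| ^+ 3.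
  by apply: norm_le_of_derive S2; rewrite sin0 subrr.
by move=> /S3; rewrite mul1r.
Qed.

Lemma cos_taylor2 x : `|x| <= 1 -> `|cos x - (1 - x ^+ 2 / 2)| <= `|x| ^+ 3.
Proof.
move=> x1; have /(_ x x1) : forall y, `|y| <= 1 ->
    `|cos y - 1 + 2^-1 * y ^+ 2| <= 1 * `|y| ^+ 4.
  apply: (@norm_le_of_derive _ (fun y => - (sin y - y))).
  - move=> y; apply: (is_derive_eq (is_deriveD (is_deriveB (is_derive_cos y)
      (is_derive_cst (1 : R) y 1))
      (is_deriveZ 2^-1 (is_deriveX 2 (is_derive_id y (1 : R)))))).
    rewrite /= subr0 /GRing.scale/= expr1 !mulr_natl mulr1 opprB addrC.
    by congr (_ - _); lra.
  - by rewrite cos0; ring.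
  - by move=> y y1; rewrite normrN mul1r sin_taylor2.
rewrite mul1r => H; have -> : cos x - (1 - x ^+ 2 / 2) =
    cos x - 1 + 2^-1 * x ^+ 2 by ring.
by apply: le_trans H _; apply: ler_wiXn2l.
Qed.

(** The function [cosh (s x) * cos (t y)] is an eigenfunction of the four-point
    Laplacian of step [h], with the left-hand side below as eigenvalue;
    its leading term is [(s ^ 2 - t ^ 2) * h ^ 2], which is negative. *)
Lemma cosh_cos_lt s t : 0 < s -> s < t -> exists k d : R, [/\ 0 < k, 0 < d &
  forall h, 0 < h < d ->
    expR (s * h) + expR (- (s * h)) + 2 * cos (t * h) - 4 <= - (k * h ^+ 2)].
Proof.
move=> s0 st; have t0 : 0 < t by apply: lt_trans st.
pose k := (t ^+ 2 - s ^+ 2) / 2; pose K := 2 * expR 1 * s ^+ 3 + 2 * t ^+ 3.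
have k0 : 0 < k by rewrite divr_gt0// subr_gt0 ltrXn2r// ?nnegrE ltW.
have K0 : 0 < K.
  by rewrite addr_gt0// !mulr_gt0// ?exprn_gt0 ?expR_gt0.
exists k, (Num.min t^-1 (k / K)); split=> //.
  by rewrite lt_min invr_gt0 t0 divr_gt0.
move=> h /andP[h0]; rewrite lt_min => /andP[ht hK].
have th1 : `|t * h| <= 1.
  by rewrite ger0_norm ?mulr_ge0 ?(ltW t0, ltW h0)// mulrC -ler_pdivlMr// div1r ltW.
have sh1 : `|s * h| <= 1.
  apply: le_trans th1; rewrite !normrM ler_wpM2r//.
  by rewrite !gtr0_norm// ltW.
have E1 := expR_taylor2 sh1.
have E2 := expR_taylor2 (etrans (congr1 (fun x => x <= 1) (normrN _)) sh1).
have C := cos_taylor2 th1.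
move: E1 E2 C; rewrite normrN sqrrN !ler_distl => /andP[_ E1] /andP[_ E2] /andP[_ C].
have sh : `|s * h| = s * h by rewrite gtr0_norm// mulr_gt0.
have th : `|t * h| = t * h by rewrite gtr0_norm// mulr_gt0.
rewrite sh th !exprMn in E1 E2 C.
have : K * h ^+ 3 <= k * h ^+ 2.
  by rewrite exprS mulrA ler_wpM2r ?sqr_ge0// mulrC -ler_pdivlMr// ltW.
rewrite /K /k => HK.
lra.
Qed.

End RealEstimates.

(** * The complex exponential *)

Section ComplexExp.
Variable R : realType.
Implicit Types z w : R[i].

Definition cexp z : R[i] :=
  (expR (complex.Re z))%:C * (cos (complex.Im z) +i* sin (complex.Im z)).

Lemma cexpD z w : cexp (z + w) = cexp z * cexp w.
Proof.
case: z => a b; case: w => c e; rewrite /cexp /= expRD cosD sinD.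
by simpc; congr (_ +i* _); ring.
Qed.

Lemma cabs_cos_sin (t : R) : cabs (cos t +i* sin t) = 1.
Proof. by rewrite /= cos2Dsin2 sqrtr1. Qed.

Lemma cabs_cexp z : cabs (cexp z) = expR (complex.Re z).
Proof. by rewrite cabsM cabs_cos_sin mulr1 cabsR ger0_norm ?expR_ge0. Qed.

Lemma cexp0 : cexp 0 = 1.
Proof. by rewrite /cexp /= expR0 cos0 sin0; simpc. Qed.

(** Multiply the expansions of [exp x] and of [cos y + i sin y] at [h = x + i y]. *)
Lemma cexp_expands2 : expands2 (fun h => cexp h - 1).
Proof.
pose x (h : R[i]) : R[i] := (complex.Re h)%:C.
pose y (h : R[i]) : R[i] := 'i%C * (complex.Im h)%:C.
have xy h : x h + y h = h by rewrite [RHS]complexE.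
have xO : bigO_at0 1 x.
  by exists 1, 1; split=> // h _; rewrite cabsR mul1r expr1 cabs_Re.
have yO : bigO_at0 1 y.
  exists 1, 1; split=> // h _.
  by rewrite cabsM cabs_i cabsR !mul1r expr1 cabs_Im.
pose T (h : R[i]) : R[i] := 1 + 1 * h + 2^-1 * h ^+ 2.
have T0 : bigO_at0 0 T := bigO_at0_poly 1 1 2^-1.
have exO : bigO_at0 3 (fun h => (expR (complex.Re h))%:C - T (x h)).
  exists (expR 1), 1; split; rewrite ?expR_ge0// => h h1.
  have re1 : `|complex.Re h| <= 1 by rewrite (le_trans (cabs_Re _))// ltW.
  have -> : (expR (complex.Re h))%:C - T (x h) =
      (expR (complex.Re h) - (1 + complex.Re h + (complex.Re h) ^+ 2 / 2))%:C.
    rewrite /T /x.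
    rewrite !(rmorphB, rmorphD, rmorphM, fmorphV, rmorphXn, rmorph1, rmorph_nat)/=.
    by ring.
  rewrite cabsR (le_trans (expR_taylor2 re1))// ler_wpM2l ?expR_ge0//.
  by rewrite lerXn2r ?nnegrE ?cabs_ge0// cabs_Re.
pose E (h : R[i]) : R[i] := cos (complex.Im h) +i* sin (complex.Im h).
have eyO : bigO_at0 3 (fun h => E h - T (y h)).
  exists 2, 1; split; rewrite// => h h1.
  have im1 : `|complex.Im h| <= 1 by rewrite (le_trans (cabs_Im _))// ltW.
  have -> : E h - T (y h) =
      (cos (complex.Im h) - (1 - (complex.Im h) ^+ 2 / 2)) +i*
      (sin (complex.Im h) - complex.Im h).
    rewrite [E h]complexE [RHS]complexE /T /y exprMn sqr_i /=.
    rewrite !(rmorphB, rmorphD, rmorphM, fmorphV, rmorphXn, rmorph1, rmorph_nat)/=.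
    by ring.
  rewrite (le_trans (cabs_ReIm _ _))//.
  have -> : 2 * cabs h ^+ 3 = cabs h ^+ 3 + cabs h ^+ 3 by ring.
  have im3 : `|complex.Im h| ^+ 3 <= cabs h ^+ 3.
    by rewrite lerXn2r ?nnegrE ?cabs_ge0// cabs_Im.
  by rewrite lerD// (le_trans _ im3)// ?cos_taylor2 ?sin_taylor2.
have Tx0 : bigO_at0 0 (fun h => T (x h)) := bigO_at0_comp T0 xO.
have Ty0 : bigO_at0 0 (fun h => T (y h)) := bigO_at0_comp T0 yO.
have E0 : bigO_at0 0 E.
  apply: bigO_at0_ext (bigO_at0D (bigO_at0W (isT : (0 <= 3)%N) eyO) Ty0) => h.
  by rewrite subrK.
have cubicO : bigO_at0 3
    (fun h => (x h * y h) * (2^-1 * (x h + y h) + 4^-1 * (x h * y h))).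
  have xyO : bigO_at0 1 (fun h => x h * y h).
    exact: (bigO_at0W (isT : (1 <= 2)%N) (bigO_at0M xO yO)).
  apply: (bigO_at0M (bigO_at0M xO yO)).
  apply: (bigO_at0D (bigO_at0M (bigO_at0_cst _) (bigO_at0D xO yO))).
  exact: (bigO_at0M (bigO_at0_cst _) xyO).
exists 0, 1, 2^-1.
apply: bigO_at0_ext (bigO_at0D (bigO_at0D (bigO_at0M exO E0)
  (bigO_at0M Tx0 eyO)) cubicO) => h.
have -> : cexp h - 1 - (0 + 1 * h + 2^-1 * h ^+ 2) =
    cexp h - 1 - (0 + 1 * (x h + y h) + 2^-1 * (x h + y h) ^+ 2).
  by rewrite xy.
by rewrite /cexp -/(E h) /T; field.
Qed.

End ComplexExp.

(** * Strict failure of the maximum property *)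

Section StrictSubmean.
Variable R : realType.

(** The product of [f] over the four rotations of [h] differs from [f 0 ^+ 4] by
    [O(h ^ 3)], while the exponential factor on the left is at most
    [1 - const * h ^ 2]: the quadratic loss wins for small [h]. *)
Lemma expands2_not_max (f : R[i] -> R[i]) (P s t d : R) :
  expands2 f -> f 0 != 0 -> 0 < P -> 0 < s -> s < t -> 0 < d ->
  exists2 h : R, 0 < h < d &
    cabs (f 0) ^+ 4 *
      expR (P * (expR (s * h) + expR (- (s * h)) + 2 * cos (t * h) - 4)) <
    cabs (f h%:C * f (- h%:C) * (f ('i%C * h%:C) * f (- ('i%C * h%:C)))).
Proof.
move=> /expands2_rotations[K [r [K0 r0 H]]] f0 P0 s0 st d0.
have [k [e [k0 e0 Hk]]] := cosh_cos_lt s0 st.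
set A := cabs (f 0) ^+ 4; pose m := P * k.
have A0 : 0 < A.
  rewrite exprn_gt0// lt0r cabs_ge0 andbT.
  by apply: contra f0 => /eqP/Normc.eq0_normc ->.
have m0 : 0 < m by rewrite mulr_gt0.
(* For [h < b] the cubic error [K * h ^+ 3] is smaller than the quadratic gain
   [A * m * h ^+ 2]. *)
pose b := A * m / ((K + 1) * (1 + m)).
have K10 : 0 < K + 1 by rewrite ltr_wpDl.
have m10 : 0 < 1 + m by rewrite addr_gt0.
have b0 : 0 < b by rewrite divr_gt0// mulr_gt0.
pose h := Num.min (Num.min (Num.min d r) (Num.min e 1)) b / 2.
have M0 : 0 < Num.min (Num.min (Num.min d r) (Num.min e 1)) b.
  by rewrite !lt_min d0 r0 e0 b0 ltr01.
have h0 : 0 < h by rewrite divr_gt0.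
have : h < Num.min (Num.min (Num.min d r) (Num.min e 1)) b.
  by rewrite ltr_pdivrMr// ltr_pMr// ltr1n.
rewrite !lt_min => /andP[/andP[/andP[hd hr] /andP[he h1]] hb].
exists h; first by rewrite h0.
have ch : cabs h%:C = h by rewrite cabsR gtr0_norm.
have := H h%:C; rewrite ch => /(_ hr) {}H.
set X := f _ * _ * _ in H *.
have XA : A - K * h ^+ 3 <= cabs X.
  have := cabs_sub (f 0 ^+ 4) X; rewrite cabsX -/A cabsBC => AX.
  by rewrite lerBlDr (le_trans AX)// lerD2l.
apply: lt_le_trans XA.
have q1 : expR (P * (expR (s * h) + expR (- (s * h)) + 2 * cos (t * h) - 4)) <=
    (1 + m * h ^+ 2)^-1.
  have mh : 0 < 1 + m * h ^+ 2 by rewrite ltr_wpDr// mulr_ge0 ?sqr_ge0// ltW.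
  rewrite -[leLHS]invrK -expRN lef_pV2 ?posrE ?expR_gt0//.
  rewrite (le_trans _ (expR_ge1Dx _))// lerD2l -mulrN /m -mulrA ler_pM2l//.
  by rewrite lerNr; apply: Hk; rewrite h0.
apply: le_lt_trans (ler_wpM2l (ltW A0) q1) _.
rewrite ltr_pdivrMr; last by rewrite ltr_wpDr// mulr_ge0 ?sqr_ge0// ltW.
have hb' : K * h * (1 + m) < A * m.
  move: hb; rewrite ltr_pdivlMr ?mulr_gt0// => hb.
  apply: le_lt_trans hb.
  have -> : h * ((K + 1) * (1 + m)) = K * h * (1 + m) + h * (1 + m) by ring.
  by rewrite lerDl mulr_ge0// ltW.
have hm : K * h * (1 + m * h ^+ 2) <= K * h * (1 + m).
  apply: ler_wpM2l; first by rewrite mulr_ge0// ltW.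
  rewrite lerD2l; apply: ler_piMr; first exact: ltW.
  by rewrite expr_le1// ltW.
have h20 : 0 < h ^+ 2 by rewrite exprn_gt0.
have := le_lt_trans hm hb'; rewrite -(ltr_pM2r h20) => hh.
have -> : (A - K * h ^+ 3) * (1 + m * h ^+ 2) =
  A + (A * m * h ^+ 2 - K * h * (1 + m * h ^+ 2) * h ^+ 2) by ring.
by rewrite ltrDl subr_gt0.
Qed.

End StrictSubmean.

(** * Analytic functions along a coordinate axis *)

Section Slice.
Variables (R : realType) (d : nat).
Implicit Types (F : 'rV[R[i]]_d -> R[i]) (a : 'rV[R[i]]_d) (j : 'I_d).

Definition shift_coord a j (h : R[i]) : 'rV[R[i]]_d :=
  \row_l (a 0 l + h *+ (l == j)).

Lemma shift_coord0 a j : shift_coord a j 0 = a.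
Proof. by apply/rowP => l; rewrite mxE mul0rn addr0. Qed.

Definition axis_index j (m : nat) : {ffun 'I_d -> nat} :=
  [ffun l => m * (l == j)]%N.

Lemma axis_index_inj j : injective (axis_index j).
Proof.
by move=> m n /(congr1 (fun k : {ffun _} => k j)); rewrite !ffunE eqxx !muln1.
Qed.

Lemma nbhs_cabs (z : R[i]) (e : R) : 0 < e ->
  nbhs z [set w | cabs (w - z) < e].
Proof.
move=> e0; apply/nbhs_ballP; exists e%:C; first by rewrite /= ltcR.
move=> w; rewrite -ball_normE /= => zw.
by rewrite cabsBC -ltcR.
Qed.

(** Along a coordinate axis only the multi-indices supported on that axis
    contribute, and the unordered sum becomes an ordinary power series. *)
Lemma analytic_at_slice F a j : analytic_at F a ->
  exists (e : R) (c : nat -> R[i]), 0 < e /\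
    forall h, cabs h < e -> forall eps : R, 0 < eps ->
    exists N0, forall N, (N0 <= N)%N ->
      cabs (F (shift_coord a j h) - \sum_(m < N) c m * h ^+ m) < eps.
Proof.
move=> [e [c [e0 H]]]; exists e, (fun m => c (axis_index j m)); split=> //.
move=> h he eps eps0.
have zE l : shift_coord a j h 0 l - a 0 l = h *+ (l == j).
  by rewrite mxE addrAC subrr add0r.
have := H (shift_coord a j h); set f := (fun k => c k * _) => {}H.
have fe m : f (axis_index j m) = c (axis_index j m) * h ^+ m.
  rewrite /f (bigD1 j)//= big1 => [|l /negbTE lj].
    by rewrite mulr1 zE eqxx ffunE eqxx muln1.
  by rewrite ffunE lj muln0 expr0.
have f0 (k : {ffun 'I_d -> nat}) : k != axis_index j (k j) -> f k = 0.
  move=> kj; have [l /andP[lj kl]] : exists l, (l != j) && (k l != 0%N).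
    apply/existsP; apply: contraR kj; rewrite negb_exists => /forallP kj.
    apply/eqP/ffunP => l; rewrite ffunE.
    have [->|lj] := eqVneq l j; first by rewrite muln1.
    by have := kj l; rewrite lj/= negbK muln0 => /eqP.
  rewrite /f (bigD1 l)//= zE (negbTE lj) mulr0n expr0n (negbTE kl).
  by rewrite mul0r mulr0.
have [] := H _ _ (nbhs_cabs (F (shift_coord a j h)) eps0).
  by move=> l; rewrite zE; case: (l == j); rewrite ?mulr1n// mulr0n Normc.normc0.
move=> J0 _ HJ.
(* The sum only serves as an upper bound for the exponents occurring in [J0]. *)
pose N0 := (\sum_(k <- J0) (k j).+1)%N.
exists N0 => N N0N.
have J0N (k : {ffun 'I_d -> nat}) : k \in J0 -> (k j < N)%N.
  move=> kJ; apply: leq_trans N0N; rewrite /N0 (big_rem k)//=.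
  exact: leq_addr.
(* Adding the first [N] axis multi-indices to [J0] makes the partial sum over
   [J] an initial segment of the one-variable power series. *)
pose E := [seq axis_index j m | m <- iota 0 N].
pose J := (J0 `|` [fset k in E])%fset.
have := HJ J (fsubsetUl _ _); rewrite /= /summability.partial_sum.
suff -> : \sum_(i : J) f (val i) = \sum_(m < N) c (axis_index j m) * h ^+ m.
  by rewrite cabsBC.
rewrite -(big_seq_fsetE _ _ predT f)/= (bigID (mem E))/= [X in _ + X]big1_seq ?addr0.
  rewrite -big_filter (perm_big E); last first.
    apply: uniq_perm.
    - by rewrite filter_uniq ?fset_uniq.
    - by rewrite map_inj_uniq ?iota_uniq//; exact: axis_index_inj.
    move=> k; rewrite mem_filter /J in_fsetU !inE/=.
    by case kE: (k \in E); rewrite ?orbT.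
  rewrite /E big_map -{1}[N]subn0 -/(index_iota 0 N) big_mkord.
  by apply: eq_bigr => m _.
move=> k /andP[kE]; rewrite /J in_fsetU in_fset (negbTE kE) orbF => kJ.
apply: f0; apply: contra kE => /eqP ->.
by apply: map_f; rewrite mem_iota/= add0n J0N.
Qed.

Lemma geometric_le2 (q : R) n : 0 <= q <= 2^-1 -> \sum_(m < n) q ^+ m <= 2.
Proof.
move=> /andP[q0 q2].
have E : (1 - q) * \sum_(m < n) q ^+ m = 1 - q ^+ n.
  elim: n => [|n IH]; first by rewrite big_ord0 expr0; ring.
  by rewrite big_ord_recr mulrDr IH exprS /=; ring.
have S0 : 0 <= \sum_(m < n) q ^+ m by apply: sumr_ge0 => i _; rewrite exprn_ge0.
have qn : 0 <= q ^+ n by rewrite exprn_ge0.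
by nra.
Qed.

(** Convergence at one point [s > 0] bounds the terms [c m * s ^+ m], so that for
    [2 * cabs h <= s] the tail of the power series from degree 3 on is dominated
    by a geometric series. *)
Lemma expands2_slice F a j : analytic_at F a ->
  expands2 (fun h => F (shift_coord a j h)).
Proof.
move=> /(analytic_at_slice j)[e [c [e0 H]]].
have [s s0 se] : exists2 s, 0 < s & s < e.
  by exists (e / 2); [exact: divr_gt0|rewrite ltr_pdivrMr// ltr_pMr// ltr1n].
have cs : cabs s%:C = s by rewrite cabsR gtr0_norm.
have [B B0 HB] : exists2 B, 0 <= B & forall m, cabs (c m) * s ^+ m <= B.
  have := H s%:C; rewrite cs => /(_ se 1 ltr01)[N0 HN].
  have S0 : 0 <= \sum_(m < N0) cabs (c m) * s ^+ m.
    by apply: sumr_ge0 => m _; rewrite mulr_ge0 ?cabs_ge0// exprn_ge0// ltW.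
  exists (2 + \sum_(m < N0) cabs (c m) * s ^+ m); first exact: addr_ge0.
  move=> m; have [mN|Nm] := ltnP m N0.
    rewrite (bigD1 (Ordinal mN))//= addrCA lerDl addr_ge0//.
    by apply: sumr_ge0 => l _; rewrite mulr_ge0 ?cabs_ge0// exprn_ge0// ltW.
  (* A term is the difference of two consecutive partial sums. *)
  have H1 := HN _ Nm; have H2 := HN _ (leqW Nm).
  rewrite -[leLHS]addr0 lerD// -[s in leLHS]cs -cabsX -cabsM.
  move: H1 H2; rewrite big_ord_recr/=; set f := F _; set S := \sum_(_ < _) _.
  move=> H1 H2.
  have -> : c m * s%:C ^+ m = (f - S) - (f - (S + c m * s%:C ^+ m)) by ring.
  by rewrite (le_trans (cabsB _ _))//; lra.
exists (c 0%N), (c 1%N), (c 2%N), (2 * B / s ^+ 3), (s / 2).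
have s30 : 0 < s ^+ 3 by rewrite exprn_gt0.
split; [exact: divr_ge0 (mulr_ge0 _ B0) (ltW s30)|exact: divr_gt0|].
move=> h hs; have he : cabs h < e.
  by apply: lt_trans se; apply: lt_le_trans hs _; lra.
apply/ler_addgt0Pr => eps eps0.
have [N0 /(_ _ (leq_addl 3 N0))] := H h he eps eps0.
rewrite add3n !big_ord_recl/= expr0 expr1 mulr1 /bump !add1n/=.
set T := \sum_(_ < _) _ => HT.
have -> : F (shift_coord a j h) - (c 0%N + c 1%N * h + c 2%N * h ^+ 2) =
  (F (shift_coord a j h) - (c 0%N + (c 1%N * h + (c 2%N * h ^+ 2 + T)))) + T.
  by ring.
rewrite (le_trans (cabsD _ _))// addrC lerD//; last exact: ltW.
rewrite {HT}/T (le_trans (cabs_sum _ _ _))//.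
pose q := cabs h / s.
have q0 : 0 <= q by rewrite divr_ge0 ?cabs_ge0// ltW.
have q2 : q <= 2^-1 by rewrite ler_pdivrMr// mulrC ltW.
apply: (@le_trans _ _ (\sum_(m < N0) B * q ^+ 3 * q ^+ m)).
  apply: ler_sum => m _; rewrite cabsM cabsX -mulrA -exprD add3n.
  have -> : B * q ^+ m.+3 = B / s ^+ m.+3 * cabs h ^+ m.+3.
    by rewrite /q expr_div_n (mulrC (cabs h ^+ _)) mulrA.
  rewrite !add1n.
  apply: ler_wpM2r; first by rewrite exprn_ge0 ?cabs_ge0.
  by rewrite ler_pdivlMr ?exprn_gt0.
rewrite -mulr_sumr.
have -> : 2 * B / s ^+ 3 * cabs h ^+ 3 = B * q ^+ 3 * 2.
  by rewrite /q expr_div_n; ring.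
apply: ler_wpM2l; first by rewrite mulr_ge0 ?exprn_ge0.
by apply: geometric_le2; rewrite q0.
Qed.

End Slice.

(** * The damping functions *)

Section Damping.
Variable R : realType.
Implicit Types s t c x y k : R.

(** This is [2 * cosh (s x) * cos (t (y - c))]: where the cosine is
    positive it grows like [exp (s |x|)] and, for [s < t], it is strictly
    superharmonic. *)
Definition damp s t c x y := (expR (s * x) + expR (- (s * x))) * cos (t * (y - c)).

Lemma damp_rotations s t c x y h :
  damp s t c (x + h) y + damp s t c (x - h) y +
  (damp s t c x (y + h) + damp s t c x (y - h)) =
  damp s t c x y * (expR (s * h) + expR (- (s * h)) + 2 * cos (t * h)).
Proof.
rewrite /damp.
have -> : s * (x + h) = s * x + s * h by ring.
have -> : s * (x - h) = s * x + - (s * h) by ring.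
have -> : - (s * x + s * h) = - (s * x) + - (s * h) by ring.
have -> : - (s * x + - (s * h)) = - (s * x) + s * h by ring.
have -> : t * (y + h - c) = t * (y - c) + t * h by ring.
have -> : t * (y - h - c) = t * (y - c) - t * h by ring.
by rewrite !expRD cosD cosB; ring.
Qed.

Lemma damp_ge s t c x y (a b : R) : 0 < t -> c = (a + b) / 2 ->
  t * (b - a) < pi -> a <= y <= b ->
  cos (t * (b - a) / 2) * expR (s * `|x|) <= damp s t c x y.
Proof.
move=> t0 -> tab /andP[ay yb]; rewrite /damp mulrC.
have hy : `|t * (y - (a + b) / 2)| <= t * (b - a) / 2.
  rewrite normrM (gtr0_norm t0) -mulrA ler_wpM2l ?(ltW t0)// ler_norml.
  by apply/andP; split; lra.
have hp : 0 <= t * (b - a) / 2.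
  by rewrite divr_ge0// mulr_ge0 ?(ltW t0)// subr_ge0 (le_trans ay).
have pi0 := pi_gt0 R.
apply: ler_pM; rewrite ?expR_ge0//.
- by apply: cos_ge0_pihalf; apply/andP; split; lra.
- have [x0|x0] := leP 0 x.
    by rewrite ger0_norm// lerDl expR_ge0.
  by rewrite ltr0_norm// mulrN lerDr expR_ge0.
- rewrite -[leRHS]cos_norm leNgt ltr_cos ?in_itv/= -?leNgt//; apply/andP; split=> //.
  + by lra.
  + by lra.
Qed.

(** With [rho < s], the factor [exp ((s - rho) |x|)] is at least
    [1 + (s - rho) |x|], so that the second term beats the first linearly. *)
Lemma exp_growth_absorbed (r rho k s : R) : 0 <= r -> 0 < k -> 0 < rho -> rho < s ->
  (exists2 B, 0 <= B &
     forall x, r * expR (rho * x) - k * expR (s * `|x|) <= B) /\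
  (forall T, 0 <= T -> exists2 X, 0 <= X &
     forall x, X <= `|x| -> r * expR (rho * x) - k * expR (s * `|x|) <= - T).
Proof.
move=> r0 k0 rho0 rs.
have ks : 0 < k * (s - rho) by rewrite mulr_gt0// subr_gt0.
have far T : 0 <= T -> exists2 X, 0 <= X &
     forall x, X <= `|x| -> r * expR (rho * x) - k * expR (s * `|x|) <= - T.
  move=> T0; exists ((r + T) / (k * (s - rho))).
    by rewrite divr_ge0 ?addr_ge0 ?(ltW ks).
  move=> x; rewrite ler_pdivrMr// => Xx.
  have E1 : expR (rho * x) <= expR (rho * `|x|).
    by rewrite ler_expR ler_wpM2l ?(ltW rho0)// ler_norm.
  have -> : s * `|x| = rho * `|x| + (s - rho) * `|x| by ring.
  rewrite expRD.
  have E2 := expR_ge1Dx ((s - rho) * `|x|).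
  have E3 : 1 <= expR (rho * `|x|).
    by rewrite -expR0 ler_expR mulr_ge0// ltW.
  set A := expR (rho * `|x|) in E1 E3 *.
  have A0 : 0 <= A by rewrite expR_ge0.
  apply: (@le_trans _ _ (A * (r - k * (1 + (s - rho) * `|x|)))).
    rewrite mulrBr lerB//; first by rewrite mulrC ler_wpM2r.
    by rewrite [k * (A * _)]mulrCA ler_wpM2l// ler_wpM2l// ltW.
  apply: (@le_trans _ _ (A * (- T))); last by rewrite mulrN lerN2 ler_peMl.
  by rewrite ler_wpM2l//; nra.
split=> //; have [X X0 HX] := far 0 (lexx _).
exists (r * expR (rho * X)); first by rewrite mulr_ge0 ?expR_ge0.
move=> x; have [Xx|xX] := leP X `|x|.
  by rewrite (le_trans (HX _ Xx))// oppr0 mulr_ge0 ?expR_ge0.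
rewrite lerBlDr; apply: (@le_trans _ _ (r * expR (rho * X))).
  rewrite ler_wpM2l// ler_expR ler_wpM2l ?(ltW rho0)//.
  by rewrite (le_trans (ler_norm _))// ltW.
by rewrite lerDl mulr_ge0 ?expR_ge0// ltW.
Qed.

End Damping.

(** * Logarithmic coordinates *)

Section Polar.
Variables (R : realType) (d : nat).
Implicit Types (w : 'rV[R]_d * 'rV[R]_d) (j : 'I_d).

(** The pair [(x, y)] of real vectors stands for the logarithm [x + i y]; unlike
    the argument it is unambiguous, even when the openings exceed [2 * pi]. *)
Definition polar w : 'rV[R[i]]_d := \row_j cexp (w.1 0 j +i* w.2 0 j).

Definition shift_polar w j (h : R[i]) : 'rV[R]_d * 'rV[R]_d :=
  (\row_l (w.1 0 l + complex.Re h *+ (l == j)),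
   \row_l (w.2 0 l + complex.Im h *+ (l == j))).

Lemma polar_shift w j h : polar (shift_polar w j h) =
  shift_coord (polar w) j (polar w 0 j * (cexp h - 1)).
Proof.
apply/rowP => l; rewrite !mxE; case: eqVneq => [->|_]; last by rewrite !mulr0n !addr0.
rewrite !mulr1n mulrBr mulr1 [RHS]addrC subrK -cexpD; congr cexp.
by case: h => a b; simpc.
Qed.

Lemma cabs_polar w j : cabs (polar w 0 j) = expR (w.1 0 j).
Proof. by rewrite mxE cabs_cexp. Qed.

Lemma arg_in_cexp (I : set R) (x y : R) : I y -> arg_in I (cexp (x +i* y)).
Proof.
move=> Iy; split; last first.
  by exists y => //; rewrite cabs_cexp /cexp.
apply/eqP => /(congr1 (@Normc.normc R)); rewrite cabs_cexp Normc.normc0 /=.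
by apply/eqP; rewrite expR_eq0.
Qed.

Lemma sectors_polar (al be : 'I_d -> R) w :
  (forall j, al j < w.2 0 j < be j) -> sectors al be (polar w).
Proof.
by move=> H j; rewrite mxE; apply: arg_in_cexp; rewrite /= in_itv/= H.
Qed.

Lemma boundary_rays_polar (al be : 'I_d -> R) w :
  (forall j, w.2 0 j = al j \/ w.2 0 j = be j) -> boundary_rays al be (polar w).
Proof. by move=> H j; rewrite mxE; apply: arg_in_cexp; exact: H. Qed.

Lemma sectors_polarP (al be : 'I_d -> R) z : sectors al be z ->
  exists2 w, z = polar w & forall j, al j < w.2 0 j < be j.
Proof.
move=> Hz.
have /choice[y Hy] : forall j, exists y : R, al j < y < be j /\
    z 0 j = (cabs (z 0 j))%:C * (cos y +i* sin y).
  by move=> j; have [_ [y]] := Hz j; rewrite /= in_itv/= => ? ?; exists y.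
exists (\row_j ln (cabs (z 0 j)), \row_j y j); last first.
  by move=> j; rewrite mxE; have [] := Hy j.
apply/rowP => j; rewrite !mxE /cexp /= lnK; first by have [] := Hy j.
rewrite posrE lt0r cabs_ge0 andbT; apply/negP => /eqP/Normc.eq0_normc z0.
by have [] := Hz j; rewrite z0 eqxx.
Qed.

Lemma continuous_coord1 j : continuous (fun w => w.1 0 j).
Proof.
move=> w; apply: (@continuous_comp _ _ _ fst (fun v : 'rV[R]_d => v 0 j)).
  exact: cvg_fst.
exact: coord_continuous.
Qed.

Lemma continuous_coord2 j : continuous (fun w => w.2 0 j).
Proof.
move=> w; apply: (@continuous_comp _ _ _ snd (fun v : 'rV[R]_d => v 0 j)).
  exact: cvg_snd.
exact: coord_continuous.
Qed.

Lemma continuous_polar : continuous polar.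
Proof.
move=> w; apply/cvg_ballP => e e0.
have [e1 e10 eE] : exists2 e1 : R, 0 < e1 & e = e1%:C.
  move: e0; case: e => a b; rewrite ltcE /= => /andP[/eqP -> a0].
  by exists a.
have H j : \forall w' \near w, cabs (polar w 0 j - polar w' 0 j) < e1.
  have cre : continuous (fun v : 'rV[R]_d * 'rV[R]_d =>
      expR (v.1 0 j) * cos (v.2 0 j) : R).
    move=> v; apply: cvgM.
      by apply: continuous_comp; [exact: continuous_coord1|exact: continuous_expR].
    by apply: continuous_comp; [exact: continuous_coord2|exact: continuous_cos].
  have cim : continuous (fun v : 'rV[R]_d * 'rV[R]_d =>
      expR (v.1 0 j) * sin (v.2 0 j) : R).
    move=> v; apply: cvgM.
      by apply: continuous_comp; [exact: continuous_coord1|exact: continuous_expR].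
    by apply: continuous_comp; [exact: continuous_coord2|exact: continuous_sin].
  have e12 : 0 < e1 / 2 by rewrite divr_gt0.
  have /cvgrPdist_lt/(_ _ e12) Hre := cre w.
  have /cvgrPdist_lt/(_ _ e12) Him := cim w.
  near=> w'.
  rewrite !mxE.
  have -> : cexp (w.1 0 j +i* w.2 0 j) - cexp (w'.1 0 j +i* w'.2 0 j) =
    (expR (w.1 0 j) * cos (w.2 0 j) - expR (w'.1 0 j) * cos (w'.2 0 j)) +i*
    (expR (w.1 0 j) * sin (w.2 0 j) - expR (w'.1 0 j) * sin (w'.2 0 j)).
    by rewrite /cexp /=; simpc.
  apply: le_lt_trans (cabs_ReIm _ _) _.
  rewrite [e1]splitr; apply: ltrD; near: w'.
    exact: Hre.
  exact: Him.
have /filter_forall {}H := H; move: H; apply: filterS => w' H.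
split=> // i j; rewrite ord1 -ball_normE /= eE.
by have := H j; rewrite -ltcR.
Unshelve. all: by end_near. Qed.

(** Contract the imaginary parts slightly towards the middle of the strips. *)
Lemma closure_sectors_polar (al be : 'I_d -> R) w :
  (forall j, al j < be j) -> (forall j, al j <= w.2 0 j <= be j) ->
  closure (sectors al be) (polar w).
Proof.
move=> ab Hw.
pose v : 'rV[R]_d := \row_j ((al j + be j) / 2 - w.2 0 j).
pose g (t : R) : 'rV[R]_d * 'rV[R]_d := (w.1, w.2 + t *: v).
have gc : {for 0, continuous g}.
  have c2 : w.2 + t *: v @[t --> (0 : R)] --> w.2 + 0 *: v.
    by apply: cvgD; [exact: cvg_cst|apply: cvgZr_tmp; exact: cvg_id].
  exact: (cvg_pair (cvg_cst w.1) c2).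
have g0 : g 0 = w by rewrite /g scale0r addr0; case: (w).
have pg : polar (g t) @[t --> 0^'+] --> polar w.
  rewrite -[X in polar X]g0; apply: cvg_at_right_filter.
  by apply: (continuous_comp gc); exact: continuous_polar.
apply: (closed_cvg _ (@closed_closure _ _) _ _ pg).
near=> t; apply: subset_closure; apply: sectors_polar => j.
rewrite !mxE; have := Hw j; have := ab j.
have t0 : 0 < t by [].
have t1 : t < 1 by near: t; exact: nbhs_right_lt.
move=> abj /andP[ay yb].
by apply/andP; split; nra.
Unshelve. all: by end_near. Qed.

End Polar.

(** * The maximum principle for the damped modulus *)

Section DampedModulus.
Variables (R : realType) (d : nat) (al be s t : 'I_d -> R).
Variables (F : 'rV[R[i]]_d -> R[i]) (eps : R).
Hypothesis ab : forall j, al j < be j.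
Hypothesis s0 : forall j, 0 < s j.
Hypothesis st : forall j, s j < t j.
Hypothesis tab : forall j, t j * (be j - al j) < pi.
Hypothesis eps0 : 0 < eps.
Hypothesis F_analytic : analytic_on (sectors al be) F.
Hypothesis F_cont : {within closure (sectors al be), continuous F}.
Implicit Types (w : 'rV[R]_d * 'rV[R]_d) (j : 'I_d) (X : 'I_d -> R).

Definition total_damp w :=
  \sum_j damp (s j) (t j) ((al j + be j) / 2) (w.1 0 j) (w.2 0 j).

Definition damped w := cabs (F (polar w)) * expR (- (eps * total_damp w)).

Let t0 j : 0 < t j. Proof. exact: lt_trans (st j). Qed.

Lemma cos_half_gt0 j : 0 < cos (t j * (be j - al j) / 2).
Proof.
have h0 : 0 < t j * (be j - al j) by rewrite mulr_gt0// subr_gt0.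
have pi0 := pi_gt0 R; have := tab j.
by move=> h; apply: cos_gt0_pihalf; apply/andP; split; lra.
Qed.

Lemma damp_term_ge w j : al j <= w.2 0 j <= be j ->
  cos (t j * (be j - al j) / 2) * expR (s j * `|w.1 0 j|) <=
  damp (s j) (t j) ((al j + be j) / 2) (w.1 0 j) (w.2 0 j).
Proof. exact: damp_ge. Qed.

Lemma damp_term_gt0 w j : al j <= w.2 0 j <= be j ->
  0 < damp (s j) (t j) ((al j + be j) / 2) (w.1 0 j) (w.2 0 j).
Proof.
move=> /damp_term_ge; apply: lt_le_trans.
by rewrite mulr_gt0 ?expR_gt0// cos_half_gt0.
Qed.

Lemma total_damp_ge0 w : (forall j, al j <= w.2 0 j <= be j) ->
  0 <= total_damp w.
Proof. by move=> H; apply: sumr_ge0 => j _; exact/ltW/damp_term_gt0. Qed.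

Lemma total_damp_shift w j (h : R[i]) :
  total_damp (shift_polar w j h) = total_damp w +
  (damp (s j) (t j) ((al j + be j) / 2)
     (w.1 0 j + complex.Re h) (w.2 0 j + complex.Im h) -
   damp (s j) (t j) ((al j + be j) / 2) (w.1 0 j) (w.2 0 j)).
Proof.
rewrite /total_damp (bigD1 j)//= [in RHS](bigD1 j)//= !mxE eqxx !mulr1n.
rewrite (eq_bigr (fun l =>
  damp (s l) (t l) ((al l + be l) / 2) (w.1 0 l) (w.2 0 l))); first by ring.
by move=> l /negbTE lj; rewrite !mxE lj !mulr0n !addr0.
Qed.

(** Move only the coordinate [j]. If none of the four points [h, - h, ih, - ih]
    increased [damped], the product of the four inequalities would bound the
    four-point product of [F] by [cabs (F (polar w)) ^+ 4] times the exponential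
    of the four-point Laplacian of the damping, against [expands2_not_max]. *)
Lemma damped_not_max w j (e : R) :
  (forall l, al l < w.2 0 l < be l) -> F (polar w) != 0 -> 0 < e ->
  exists2 h : R[i], cabs h < e & damped w < damped (shift_polar w j h).
Proof.
move=> Hw Fw0 e0; apply: contrapT => Hmax.
have {}Hmax h : cabs h < e -> damped (shift_polar w j h) <= damped w.
  move=> he; rewrite leNgt; apply/negP => wh; apply: Hmax; by exists h.
pose g (h : R[i]) := polar w 0 j * (cexp h - 1).
pose f h := F (shift_coord (polar w) j (g h)).
have fE h : f h = F (polar (shift_polar w j h)) by rewrite polar_shift.
have g0 : g 0 = 0 by rewrite /g cexp0 subrr mulr0.
have f0 : f 0 = F (polar w) by rewrite /f g0 shift_coord0.
have f2 : expands2 f.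
  apply: (expands2_comp (f := fun k => F (shift_coord (polar w) j k)) g0).
    exact/expands2_slice/F_analytic/sectors_polar.
  have lin2 : expands2 (fun k => polar w 0 j * k).
    exists 0, (polar w 0 j), 0, 0, 1; split=> // h _.
    by rewrite add0r mul0r addr0 subrr Normc.normc0 mul0r.
  have e00 : cexp 0 - 1 = 0 :> R[i] by rewrite cexp0 subrr.
  exact: (expands2_comp (g := fun h => cexp h - 1) e00 lin2 (@cexp_expands2 R)).
pose p x y := damp (s j) (t j) ((al j + be j) / 2) x y.
set x := w.1 0 j; set y := w.2 0 j.
have p0 : 0 < p x y.
  by apply: damp_term_gt0; have /andP[/ltW -> /ltW ->] := Hw j.
rewrite -f0 in Fw0.
have [h /andP[h0 he]] := expands2_not_max f2 Fw0 (mulr_gt0 eps0 p0) (s0 j) (st j) e0.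
apply/negP; rewrite -leNgt.
have fle k : cabs k < e -> cabs (f k) <=
    cabs (f 0) * expR (eps * (p (x + complex.Re k) (y + complex.Im k) - p x y)).
  move=> /Hmax; rewrite /damped -fE -f0 total_damp_shift -/x -/y -/(p _ _).
  rewrite -/(p x y) mulrDr opprD expRD mulrA.
  rewrite [_ * expR _ * expR _]mulrAC ler_pM2r ?expR_gt0//.
  by rewrite [expR (- _)]expRN ler_pdivrMr ?expR_gt0.
have ch : cabs h%:C < e by rewrite cabsR gtr0_norm.
have cNh : cabs (- h%:C) < e by rewrite cabsN.
have cih : cabs ('i%C * h%:C) < e by rewrite cabsM cabs_i mul1r.
have cNih : cabs (- ('i%C * h%:C)) < e by rewrite cabsN.
have := ler_pM (mulr_ge0 (cabs_ge0 _) (cabs_ge0 _)) (mulr_ge0 (cabs_ge0 _) (cabs_ge0 _))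
  (ler_pM (cabs_ge0 _) (cabs_ge0 _) (fle _ ch) (fle _ cNh))
  (ler_pM (cabs_ge0 _) (cabs_ge0 _) (fle _ cih) (fle _ cNih)).
rewrite !cabsM; move=> H; apply: le_trans H _.
have ReN (z : R[i]) : complex.Re (- z) = - complex.Re z by case: z.
have ImN (z : R[i]) : complex.Im (- z) = - complex.Im z by case: z.
have ihE : 'i%C * h%:C = 0 +i* h by simpc.
rewrite !ReN !ImN ihE /= oppr0 !addr0.
have E4 (a a1 a2 a3 a4 : R) :
    a * expR a1 * (a * expR a2) * (a * expR a3 * (a * expR a4)) =
    a ^+ 4 * expR (a1 + a2 + (a3 + a4)) by rewrite !expRD; ring.
rewrite E4 ler_wpM2l ?exprn_ge0 ?cabs_ge0// ler_expR.
rewrite -mulrA -!mulrDr ler_pM2l//.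
have := damp_rotations (s j) (t j) ((al j + be j) / 2) x y h; rewrite -!/(p _ _).
move=> D; rewrite mulrBr -D.
lra.
Qed.

Lemma near_continuous_cabs (z : 'rV[R[i]]_d) (e : R) :
  closure (sectors al be) z -> 0 < e ->
  nbhs z [set z' | closure (sectors al be) z' -> cabs (F z' - F z) < e].
Proof.
move=> cz e1; move/subspace_continuousP : F_cont => /(_ z cz).
by move=> /(_ _ (nbhs_cabs (F z) e1)).
Qed.

Lemma continuous_total_damp : continuous total_damp.
Proof.
move=> w; rewrite /total_damp.
apply: (@cvg_big _ _ _ _ _ _ _ _ _ (fun (j : 'I_d) (w : 'rV[R]_d * 'rV[R]_d) =>
  damp (s j) (t j) ((al j + be j) / 2) (w.1 0 j) (w.2 0 j))) => [|j _].
  exact: add_continuous.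
have c1 (k : R) : {for w, continuous (fun w => k * w.1 0 j)}.
  by apply: cvgM; [exact: cvg_cst|exact: continuous_coord1].
apply: cvgM.
  apply: cvgD.
    by apply: continuous_comp (c1 _) _; exact: continuous_expR.
  apply: continuous_comp; last exact: continuous_expR.
  exact: (cvgN (c1 _)).
apply: continuous_comp; last exact: continuous_cos.
apply: cvgM; first exact: cvg_cst.
by apply: cvgB; [exact: continuous_coord2|exact: cvg_cst].
Qed.

Lemma continuous_damped (A : set ('rV[R]_d * 'rV[R]_d)) :
  (forall w, A w -> forall j, al j <= w.2 0 j <= be j) ->
  {within A, continuous damped}.
Proof.
move=> HA; apply/subspace_continuousP => w Aw.
apply: cvgM; last first.
  apply: cvg_within_filter; apply: continuous_comp; last exact: continuous_expR.
  apply: cvgN; apply: cvgM; first exact: cvg_cst.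
  exact: continuous_total_damp.
have cA w' : A w' -> closure (sectors al be) (polar w').
  by move=> /HA; exact: closure_sectors_polar.
apply/cvgrPdist_lt => e e1.
have := continuous_polar (near_continuous_cabs (cA _ Aw) e1).
rewrite /nbhs /= /within /=; apply: filterS => w' /= H Aw'.
have {H} := H (cA _ Aw'); apply: le_lt_trans.
have := cabs_sub (F (polar w)) (F (polar w')).
have := cabs_sub (F (polar w')) (F (polar w)).
rewrite (cabsBC (F (polar w)) (F (polar w'))) ler_distl => H1 H2.
by apply/andP; split; lra.
Qed.

Definition box (eta : R) X : set ('rV[R]_d * 'rV[R]_d) :=
  [set w : 'rV[R]_d * 'rV[R]_d | (forall j, - X j <= w.1 0 j <= X j) /\
           (forall j, al j + eta <= w.2 0 j <= be j - eta)].

Lemma compact_box eta X : compact (box eta X).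
Proof.
exact: (compact_setX
  (rV_compact (fun j => @segment_compact R (- X j) (X j)))
  (rV_compact (fun j => @segment_compact R (al j + eta) (be j - eta)))).
Qed.

Lemma box_le eta X : 0 <= eta -> forall w, box eta X w ->
  forall j, al j <= w.2 0 j <= be j.
Proof.
by move=> e0 w [_ Hy] j; have /andP[? ?] := Hy j; apply/andP; split; lra.
Qed.

(** The maximum over the shrunken box is attained; by hypothesis not on the faces
    in the real directions, and by [damped_not_max] no coordinate can be interior.
    Shrinking by [eta] keeps the box inside the open sectors, where [F] is
    analytic in all the variables at once. *)
Lemma box_max eta X w0 : 0 < eta -> box eta X w0 -> 0 < damped w0 ->
  (forall w, box eta X w -> forall j, `|w.1 0 j| = X j -> damped w < damped w0) ->
  exists2 w, box eta X w & damped w0 <= damped w /\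
    forall j, w.2 0 j = al j + eta \/ w.2 0 j = be j - eta.
Proof.
move=> eta0 bw0 u0 Hfar.
have [w /set_mem bw Hw] := compact_EVT_max (ex_intro _ w0 bw0) (@compact_box eta X)
  (continuous_damped (box_le (ltW eta0))).
exists w => //; have w0w : damped w0 <= damped w by apply: Hw; rewrite inE.
split=> // j; apply: contrapT => /not_orP[y1 y2].
have [wx wy] := bw.
have sec l : al l < w.2 0 l < be l.
  by have /andP[? ?] := wy l; apply/andP; split; lra.
have Fw : F (polar w) != 0.
  apply/eqP => Fw; have := lt_le_trans u0 w0w.
  by rewrite /damped Fw Normc.normc0 mul0r ltxx.
have xj : `|w.1 0 j| < X j.
  rewrite lt_neqAle ler_norml wx andbT; apply/eqP => /(Hfar _ bw).
  by rewrite ltNge w0w.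
have /andP[ya yb] := wy j.
have ya' : al j + eta < w.2 0 j by rewrite lt_neqAle ya andbT eq_sym; exact/eqP.
have yb' : w.2 0 j < be j - eta by rewrite lt_neqAle yb andbT; exact/eqP.
pose e := Num.min (X j - `|w.1 0 j|)
  (Num.min (w.2 0 j - (al j + eta)) (be j - eta - w.2 0 j)).
have e0 : 0 < e by rewrite !lt_min !subr_gt0 xj ya' yb'.
have [h he] := damped_not_max j sec Fw e0.
apply/negP; rewrite -leNgt; apply: Hw; rewrite inE.
have reh := le_lt_trans (cabs_Re h) he; have imh := le_lt_trans (cabs_Im h) he.
move: reh imh; rewrite !lt_min => /and3P[r1 _ _] /and3P[_ i2 i3].
split=> l; rewrite mxE; case: eqVneq => [->|_]; rewrite ?mulr1n ?mulr0n ?addr0//.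
  rewrite -ler_norml (le_trans (ler_normD _ _))// -lerBrDl.
  exact: ltW.
move: i2 i3; rewrite !ltr_norml => /andP[? ?] /andP[? ?].
by apply/andP; split; lra.
Qed.

Lemma exists_eta w (e : R) : (forall j, al j < w.2 0 j < be j) -> 0 < e ->
  exists2 eta, 0 < eta < e &
    forall j, al j + eta <= w.2 0 j <= be j - eta.
Proof.
move=> Hw e0.
have H : \forall eta \near (0 : R)^'+, forall j,
    al j + eta <= w.2 0 j <= be j - eta.
  apply: filter_forall => j; have /andP[ya yb] := Hw j; near=> eta.
  apply/andP; split.
    rewrite -lerBrDl; near: eta; apply: nbhs_right_le; by rewrite subr_gt0.
  rewrite lerBrDl -lerBrDr; near: eta; apply: nbhs_right_le; by rewrite subr_gt0.
have [eta [eta0 eta1 eta2]] : exists eta : R, [/\ 0 < eta, eta < e &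
    forall j, al j + eta <= w.2 0 j <= be j - eta].
  apply: (@filter_ex _ (0 : R)^'+); near=> eta; split.
  - by near: eta; exact: nbhs_right_gt.
  - by near: eta; exact: nbhs_right_lt.
  - by near: eta.
by exists eta => //; rewrite eta0.
Unshelve. all: by end_near. Qed.

(** Let [eta] tend to 0 in [box_max]. Instead of extracting a convergent
    subsequence, consider the nonnegative continuous function [G], which vanishes
    exactly at the required points: it takes arbitrarily small values at the
    points of [box_max], so its minimum over the compact closed box is 0. *)
Lemma distinguished_boundary_max X w0 :
  (forall j, `|w0.1 0 j| <= X j) ->
  (forall j, al j < w0.2 0 j < be j) -> 0 < damped w0 ->
  (forall w, (forall j, al j < w.2 0 j < be j) ->
    forall j, `|w.1 0 j| = X j -> damped w < damped w0) ->
  exists2 w, damped w0 <= damped w &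
    forall j, w.2 0 j = al j \/ w.2 0 j = be j.
Proof.
move=> wx wy u0 Hfar.
have bw0 eta : (forall j, al j + eta <= w0.2 0 j <= be j - eta) -> box eta X w0.
  by split=> // j; rewrite -ler_norml.
have box0 : box 0 X w0.
  by apply: bw0 => j; rewrite addr0 subr0; have /andP[/ltW -> /ltW ->] := wy j.
pose G w := (`|damped w0 - damped w| + (damped w0 - damped w)) +
  \sum_j (w.2 0 j - al j) * (be j - w.2 0 j).
have Gc : {within box 0 X, continuous G}.
  apply/subspace_continuousP => w bw.
  have /subspace_continuousP/(_ w bw) uc :=
    continuous_damped (box_le (X := X) (lexx 0)).
  apply: cvgD.
    have vc : damped w0 - damped w' @[w' --> within (box 0 X) (nbhs w)] -->
        damped w0 - damped w by apply: cvgB; [exact: cvg_cst|].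
    by apply: cvgD => //; exact: cvg_norm.
  apply: cvg_within_filter.
  apply: (@cvg_big _ _ _ _ _ _ _ _ _ (fun (j : 'I_d) (w : 'rV[R]_d * 'rV[R]_d) =>
    (w.2 0 j - al j) * (be j - w.2 0 j))) => [|j _].
    exact: add_continuous.
  by apply: cvgM; apply: cvgB; by [exact: cvg_cst|exact: continuous_coord2].
have [w /set_mem bw Hw] := compact_EVT_min (ex_intro _ w0 box0)
  (@compact_box 0 X) Gc.
have wj := box_le (lexx 0) bw.
have S0 j : 0 <= (w.2 0 j - al j) * (be j - w.2 0 j).
  by have /andP[? ?] := wj j; rewrite mulr_ge0// subr_ge0.
have SS : 0 <= \sum_j (w.2 0 j - al j) * (be j - w.2 0 j).
  by apply: sumr_ge0.
have G0 : G w <= 0.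
  rewrite leNgt; apply/negP => Gw.
  pose S := \sum_j (be j - al j).
  have S1 : 0 < S + 1.
    by rewrite ltr_wpDl// sumr_ge0// => j _; rewrite subr_ge0 ltW.
  have [eta /andP[eta0 eta1] Heta] := exists_eta wy (divr_gt0 Gw S1).
  have farb w' : box eta X w' -> forall j, `|w'.1 0 j| = X j ->
      damped w' < damped w0.
    move=> [_ w'y]; apply: Hfar => j.
    by have /andP[? ?] := w'y j; apply/andP; split; lra.
  have [w' bw' [uw' w'y]] := box_max eta0 (bw0 _ Heta) u0 farb.
  have /Hw : w' \in box 0 X.
    rewrite inE; split=> j; first by case: bw' => /(_ j).
    by rewrite addr0 subr0; apply: box_le (ltW eta0) _ bw' _.
  apply/negP; rewrite -ltNge {1}/G ler0_norm ?subr_le0// addNr add0r.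
  move: eta1; rewrite ltr_pdivlMr// => eta1; apply: le_lt_trans eta1.
  apply: (@le_trans _ _ (eta * S)); last by rewrite ler_pM2l// lerDl.
  rewrite mulr_sumr; apply: ler_sum => j _.
  have := ab j; case: (w'y j) => -> abj.
    by rewrite addrAC subrr add0r ler_pM2l//; lra.
  by rewrite opprB addrCA subrr addr0 mulrC ler_pM2l//; lra.
have [P1 P2] : damped w0 - damped w <= 0 /\
    \sum_j (w.2 0 j - al j) * (be j - w.2 0 j) <= 0.
  move: G0; rewrite /G; set a := damped w0 - _ => G0.
  have [a0|a0] := leP a 0; move: G0; first by rewrite ler0_norm// addNr add0r.
  by rewrite gtr0_norm//; lra.
exists w; first by rewrite -subr_le0.
move=> j; have : (w.2 0 j - al j) * (be j - w.2 0 j) = 0.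
  apply/eqP; rewrite eq_le S0 andbT; apply: le_trans P2.
  by rewrite (bigD1 j)//= lerDl sumr_ge0.
move=> /eqP; rewrite mulf_eq0 !subr_eq0 => /orP[/eqP->|/eqP->]; by [left|right].
Qed.

End DampedModulus.

(** * Growth and conclusion *)

Section PhragmenLindelof.
Variables (R : realType) (d : nat) (al be rho s t r : 'I_d -> R).
Variables (F : 'rV[R[i]]_d -> R[i]) (C M : R).
Hypothesis ab : forall j, al j < be j.
Hypothesis rho0 : forall j, 0 < rho j.
Hypothesis rhos : forall j, rho j < s j.
Hypothesis st : forall j, s j < t j.
Hypothesis tab : forall j, t j * (be j - al j) < pi.
Hypothesis F_analytic : analytic_on (sectors al be) F.
Hypothesis F_cont : {within closure (sectors al be), continuous F}.
Hypothesis C0 : 0 <= C.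
Hypothesis r0 : forall j, 0 <= r j.
Hypothesis F_growth : forall z, sectors al be z ->
  cabs (F z) <= C * \prod_(j < d) expR (r j * cabs (z 0 j) `^ rho j).
Implicit Types (w : 'rV[R]_d * 'rV[R]_d).

Let s0 j : 0 < s j. Proof. exact: lt_trans (rhos j). Qed.

(** In the logarithm of the growth bound each variable contributes a term that is
    bounded above and tends to minus infinity with [|x|], so a single large
    [|x_j|] suffices to make [damped] small, whatever the other variables are. *)
Lemma damped_far (eps : R) w0 : 0 < eps -> 0 < damped al be s t F eps w0 ->
  exists2 X : 'I_d -> R, forall j, `|w0.1 0 j| <= X j &
  forall w, (forall j, al j < w.2 0 j < be j) ->
    forall j, `|w.1 0 j| = X j ->
    damped al be s t F eps w < damped al be s t F eps w0.
Proof.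
move=> eps0 u0; set m := damped _ _ _ _ _ _ w0 in u0 *.
pose k j := eps * cos (t j * (be j - al j) / 2).
have k0 j : 0 < k j.
  by rewrite mulr_gt0// (cos_half_gt0 ab s0 st tab).
pose phi j x := r j * expR (rho j * x) - k j * expR (s j * `|x|).
have /choice[B HB] : forall j, exists B, 0 <= B /\ forall x, phi j x <= B.
  move=> j; have [[B ? ?] _] := exp_growth_absorbed (r0 j) (k0 j) (rho0 j) (rhos j).
  by exists B.
(* The choice of [T] ensures [C * exp (\sum_j B j - T) < m], by
   [exp (C / m) >= 1 + C / m]. *)
pose T := \sum_j B j + C / m.
have T0 : 0 <= T.
  by rewrite addr_ge0 ?divr_ge0 ?(ltW u0)// sumr_ge0// => j _; have [] := HB j.
have /choice[X HX] : forall j, exists X, `|w0.1 0 j| <= X /\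
    forall x, X <= `|x| -> phi j x <= - T.
  move=> j.
  have [_ /(_ T T0)[X X0 HX]] := exp_growth_absorbed (r0 j) (k0 j) (rho0 j) (rhos j).
  exists (X + `|w0.1 0 j|); split; first by rewrite lerDr.
  by move=> x Xx; apply: HX; apply: le_trans Xx; rewrite lerDl.
exists X => [j|w Hw j wX]; first by have [] := HX j.
have wle l : al l <= w.2 0 l <= be l.
  by have /andP[/ltW -> /ltW ->] := Hw l.
have uphi : damped al be s t F eps w <= C * expR (\sum_l phi l (w.1 0 l)).
  have -> : \sum_l phi l (w.1 0 l) =
      \sum_l r l * expR (rho l * w.1 0 l) +
      - (eps * \sum_l cos (t l * (be l - al l) / 2) * expR (s l * `|w.1 0 l|)).
    rewrite mulr_sumr -sumrN -big_split; apply: eq_bigr => l _.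
    by rewrite /phi /k /= mulrA.
  rewrite expRD mulrA; apply: ler_pM; rewrite ?cabs_ge0 ?expR_ge0//.
    rewrite expR_sum (eq_bigr (fun l =>
      expR (r l * cabs (polar w 0 l) `^ rho l))) => [|l _].
      exact/F_growth/sectors_polar.
    by rewrite cabs_polar -expRM (mulrC (rho l)).
  rewrite ler_expR lerN2 ler_pM2l// ler_sum// => l _.
  exact: (damp_term_ge s0 st tab).
apply: le_lt_trans uphi _.
have sphi : \sum_l phi l (w.1 0 l) <= - (C / m).
  rewrite (bigD1 j)//=; apply: (@le_trans _ _ (- T + \sum_l B l)).
    apply: lerD; first by have [_] := HX j; apply; rewrite wX.
    rewrite [leRHS](bigD1 j)//= -[leLHS]add0r lerD//; first by have [] := HB j.
    by apply: ler_sum => l _; have [_] := HB l.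
  by rewrite /T opprD addrAC addNr add0r.
apply: (@le_lt_trans _ _ (C * (1 + C / m)^-1)).
  rewrite ler_wpM2l// (le_trans (y := expR (- (C / m))))// ?ler_expR//.
  rewrite expRN lef_pV2 ?posrE ?expR_gt0 ?expR_ge1Dx//.
  by rewrite ltr_wpDr// divr_ge0// ltW.
have Cm : 0 < 1 + C / m by rewrite ltr_wpDr// divr_ge0// ltW.
rewrite ltr_pdivrMr// mulrDr mulr1 mulrCA mulfV ?gt_eqF// mulr1.
by rewrite ltrDr.
Qed.

Hypothesis M0 : 0 <= M.
Hypothesis F_boundary : forall z, boundary_rays al be z -> cabs (F z) <= M.

(** A value of [cabs F] exceeding [M] would survive a small damping, and then
    [distinguished_boundary_max] would produce a value exceeding [M] on the
    boundary rays, where the damping factor is at most 1. *)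
Lemma sectors_bound z : sectors al be z -> cabs (F z) <= M.
Proof.
move=> /sectors_polarP[w0 -> Hw0]; rewrite leNgt; apply/negP => MF.
set A := cabs _ in MF; pose Q := total_damp al be s t w0.
have w0le j : al j <= w0.2 0 j <= be j.
  by have /andP[/ltW -> /ltW ->] := Hw0 j.
have Q0 : 0 <= Q := total_damp_ge0 ab s0 st tab w0le.
have A0 : 0 < A by apply: le_lt_trans MF.
have Q10 : 0 < Q + 1 by rewrite ltr_wpDl.
(* By [exp (- eps * Q) >= 1 - eps * Q] the damping leaves the value at [w0]
   above [M]. *)
pose eps := (A - M) / (A * (Q + 1)).
have eps0 : 0 < eps by rewrite divr_gt0 ?subr_gt0// mulr_gt0.
have u0 : M < damped al be s t F eps w0.
  apply: (@lt_le_trans _ _ (A * (1 + - (eps * Q)))); last first.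
    by rewrite /damped -/A ler_pM2l// expR_ge1Dx.
  have -> : A * (1 + - (eps * Q)) = M + (A - M) / (Q + 1).
    by rewrite /eps; field; rewrite !gt_eqF.
  by rewrite ltrDl divr_gt0// subr_gt0.
have u00 := le_lt_trans M0 u0.
have [X w0X far] := damped_far eps0 u00.
have [w w0w Hw] := distinguished_boundary_max ab s0 st tab eps0 F_analytic F_cont
  w0X Hw0 u00 far.
have := lt_le_trans u0 w0w; apply/negP; rewrite -leNgt.
rewrite -[leRHS]mulr1; apply: ler_pM; rewrite ?cabs_ge0 ?expR_ge0//.
  exact/F_boundary/boundary_rays_polar.
rewrite expR_le1 oppr_le0 mulr_ge0 ?(ltW eps0)//.
apply: (total_damp_ge0 ab s0 st tab) => j.
by have := ab j; case: (Hw j) => -> ?; rewrite lexx ?andbT/= ltW.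
Qed.

End PhragmenLindelof.

Unset Implicit Arguments.
Set Strict Implicit.
Set Printing Implicit Defensive.
Local Close Scope complex_scope.

Theorem propositionA2 (R : realType) (d : nat) (al be rho : 'I_d -> R)
    (F : 'rV[R[i]]_d -> R[i]) (C M : R) (r : 'I_d -> R) :
  (1 <= d)%N ->
  (forall j, [/\ al j < be j, 0 < rho j & rho j * (be j - al j) < pi]) ->
  analytic_on (sectors al be) F ->
  {within closure (sectors al be), continuous F} ->
  0 <= C -> 0 <= M -> (forall j, 0 <= r j) ->
  (forall z, boundary_rays al be z -> cabs (F z) <= M) ->
  (forall z, sectors al be z ->
    cabs (F z) <= C * \prod_(j < d) expR (r j * cabs (z 0 j) `^ rho j)) ->
  forall z, closure (sectors al be) z -> cabs (F z) <= M.
Proof.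
move=> _ H Fan Fc C0 M0 r0 Fb Fg.
have ab j : al j < be j by have [] := H j.
have rho0 j : 0 < rho j by have [] := H j.
pose T j := pi / (be j - al j).
have rT j : rho j < T j by have [? _ ?] := H j; rewrite ltr_pdivlMr// subr_gt0.
(* Any [rho j < s j < t j < T j] would do: [s] governs the growth of the damping
   and [t] the width of the strip on which it is positive. *)
pose s j := (2 * rho j + T j) / 3; pose t j := (rho j + 2 * T j) / 3.
have rs j : rho j < s j by have := rT j; rewrite /s; lra.
have st j : s j < t j by have := rT j; rewrite /s /t; lra.
have tab j : t j * (be j - al j) < pi.
  by rewrite -ltr_pdivlMr ?subr_gt0// -/(T j); have := rT j; rewrite /t; lra.
have inside z := sectors_bound ab rho0 rs st tab Fan Fc C0 r0 Fg M0 Fb (z := z).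
move=> z cz; apply/ler_addgt0Pr => e e0.
have [z' [sz' Hz']] := cz _ (near_continuous_cabs Fc cz e0).
have := Hz' (subset_closure sz'); have := cabs_sub (F z) (F z').
by rewrite cabsBC; have := inside _ sz'; lra.
Qed.
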